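(* Let $\mathcal{G}$ be a multiple-unicasts network with $k$ sources and $m$ links, and let $G$ be the side-information digraph on $m$ vertices obtained from $\mathcal{G}$ (as defined in the context). Then for every positive integer $q$, $$R^{\mathrm{MU}}(\mathcal{G}) \;\le\; R^{\mathrm{CO}}(\mathcal{G}) \;=\; m-\beta_{\mathrm{VL}}(G)\;\le\; m-\sqrt[q]{\mathrm{MAIS}(\otimes^{q} G)} .$$
   Context: **Multiple-unicasts (MU) network.** A finite acyclic directed network $\mathcal{G}(\mathcal{N},\mathcal{E})$ (parallel links allowed), where every link $e\in\mathcal{E}$ has unit capacity and is directed from its tail $t(e)$ to its head $h(e)$. There are $k$ source nodes $s_1,\dots,s_k$ and $k$ destination nodes $t_1,\dots,t_k$. For each $i$ there is a set $\mathcal{E}_i\subset\mathcal{E}$ of exactly $\mathrm{mincut}(s_i,t_i)$ *source links* of $s_i$, which have head $s_i$ and no tail; $\mathrm{mincut}(s_i,t_i)$ is the minimum number of unit-capacity links separating $t_i$ from $s_i$. All links not in $\bigcup_i\mathcal{E}_i$ have a tail and a head. $m=|\mathcal{E}|$ counts all links, including source links. **Vector-linear network codes.** Let $\mathbb{F}$ be a finite field. A vector-linear relaxed-correlated MU network code over $\mathbb{F}$ with parameters $p\ge 1$, $r\ge 0$ consists of vectors $\mathbf{z}_e\in\mathbb{F}^p$, $e\in\mathcal{E}$, each a linear function of a message vector $\mathbf{x}\in\mathbb{F}^r$ (consisting of $r$ independent uniform subsymbols), where $\mathbf{x}\mapsto(\mathbf{z}_e)_{e\in\bigcup_i\mathcal{E}_i}$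 is injective, such that: (1) for each non-source link $e$, $\mathbf{z}_e$ is a linear function of $\{\mathbf{z}_a: h(a)=t(e)\}$; (2) for each $i$ and each $e\in\mathcal{E}_i$, $\mathbf{z}_e$ is a linear function of the information flowing into $t_i$, i.e. of $\{\mathbf{z}_a: h(a)=t_i\}$. Its joint source entropy rate is $r/p$. It is a vector-linear MU network code (independent sources) if moreover (3) the families $\{\mathbf{z}_e\}_{e\in\mathcal{E}_i}$, $i=1,\dots,k$, are mutually independent. $R^{\mathrm{CO}}(\mathcal{G};\mathbb{F})$ is the optimum (supremum) of $r/p$ over relaxed-correlated codes over $\mathbb{F}$, and $R^{\mathrm{MU}}(\mathcal{G};\mathbb{F})$ the optimum over codes that also satisfy (3); $R^{\mathrm{CO}}(\mathcal{G})$ and $R^{\mathrm{MU}}(\mathcal{G})$ are the optima over all finite fields. **The digraph $G$.** Let $\mathcal{G}'$ be the network obtained from $\mathcal{G}$ by setting $t(e)=t_i$ for all $e\in\mathcal{E}_i$, $i=1,\dots,k$. $G$ is the reversed line graph of $\mathcal{G}'$: its vertices are the $m$ links of $\mathcal{G}'$, and there is a directed edge from $e$ to $\hat e$ iff $h(\hat e)=t(e)$ in $\mathcal{G}'$. **Index coding.** For a loopless digraph $G$ on $\{1,\dots,n\}$, messages $\mathbf{x}_1,\dots,\mathbf{x}_n\in\mathbb{F}^p$ are independent; user $i$ wants $\mathbf{x}_i$ and knows $\mathbf{x}_j$ for all $j$ with $(i,j)\in E(G)$. A vector-linear index code over $\mathbb{F}$ consists of $r$ $\mathbb{F}$-linear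 combinations of the $pn$ subsymbols from which, together with its side information, each user $i$ can decode $\mathbf{x}_i$; its broadcast rate is $r/p$. $\beta_{\mathrm{VL}}^{\mathbb{F}}(G)$ is the infimum of $r/p$ over all such codes (all $p\geq 1$) over $\mathbb{F}$, and $\beta_{\mathrm{VL}}(G)=\inf_{\mathbb{F}}\beta_{\mathrm{VL}}^{\mathbb{F}}(G)$ over all finite fields. **Graph notions.** $\mathrm{MAIS}(G)$ is the cardinality of the largest $\widehat V\subseteq V(G)$ such that the subgraph of $G$ induced by $\widehat V$ has no directed cycle. The strong product $G\otimes H$ has vertex set $V(G)\times V(H)$ and an edge from $(u,v)$ to a different vertex $(u',v')$ iff ($u=u'$ or $(u,u')\in E(G)$) and ($v=v'$ or $(v,v')\in E(H)$). $\otimes^q G$ is the strong product of $q$ copies of $G$. *)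

(* Defs.v *)
From HB Require Import structures.
From mathcomp Require Import all_boot all_order all_algebra.
From mathcomp Require Import all_classical all_reals all_analysis.

Set Implicit Arguments.
Unset Strict Implicit.
Unset Printing Implicit Defensive.

Import Order.TTheory GRing.Theory Num.Theory.

Local Open Scope classical_set_scope.
Local Open Scope ring_scope.

(* [A] induces a subgraph without directed cycles; a loop is a cycle of
   length 1. *)
Definition acyclic_on (T : finType) (e : rel T) (A : {set T}) : Prop :=
  forall c : seq T, {subset c <= A} -> ucycle e c -> c = [::].

Record digraph := Digraph {
  vertex :> finType;
  edge : rel vertex;
  edge_irr : irreflexive edge }.

Definition MAIS (G : digraph) : nat :=
  (\max_(A : {set G} | `[< acyclic_on (@edge G) A >]) #|A|)%N.

Section StrongProduct.
Variables G H : digraph.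

Definition strong_edge : rel (G * H)%type := fun a b =>
  [&& a != b, (a.1 == b.1) || edge a.1 b.1 & (a.2 == b.2) || edge a.2 b.2].

Lemma strong_edge_irr : irreflexive strong_edge.
Proof. by move=> a; rewrite /strong_edge eqxx. Qed.

Definition strong_prod : digraph := Digraph strong_edge_irr.

End StrongProduct.

(* Meant for [0 < q]: [strong_power G 1] is [G]. *)
Definition strong_power (G : digraph) (q : nat) : digraph :=
  iter q.-1 (strong_prod G) G.

Section IndexCoding.
Variables (G : digraph) (F : finFieldType).

(* The [r] transmitted symbols are the entries of [\sum_v x v *m C v]. *)
Definition index_code (p r : nat) (C : G -> 'M[F]_(p, r)) : Prop :=
  forall i : G,
  exists D : 'rV[F]_r -> {ffun {j : G | edge i j} -> 'rV[F]_p} -> 'rV[F]_p,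
  forall x : G -> 'rV[F]_p,
    D (\sum_(v : G) x v *m C v) [ffun j => x (val j)] = x i.

Definition beta_VL_over (R : realType) : \bar R :=
  ereal_inf [set y | exists p r (C : G -> 'M[F]_(p, r)),
    [/\ (0 < p)%N, index_code C & y = (r%:R / p%:R)%:E]].

End IndexCoding.

Definition beta_VL (R : realType) (G : digraph) : \bar R :=
  ereal_inf [set y | exists F : finFieldType, y = beta_VL_over G F R].

Section Reachability.
Variables (k : nat) (node link : finType).
Variables (origin : link -> node + 'I_k) (hd : link -> node).

Definition step (A : {set link}) : rel node := fun u v =>
  [exists e in A, (origin e == inl u) && (hd e == v)].

Definition separates (s t : node) (C : {set link}) : bool :=
  ~~ connect (step (~: C)) s t.

(* Meaningful for [s != t], in which case the set of all links separates. *)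
Definition mincut (s t : node) : nat :=
  #|[arg min_(C < [set: link]%SET | separates s t C) #|C|]|.

End Reachability.

(* [origin e] is [inl v] when [e] has tail [v], and [inr i] when [e] is one of
   the source links of [src i], which have no tail. *)
Record network (k : nat) := Network {
  node : finType;
  link : finType;
  origin : link -> node + 'I_k;
  hd : link -> node;
  src : 'I_k -> node;
  dst : 'I_k -> node;
  network_acyclic :
    acyclic_on (step origin hd [set: link]%SET) [set: node]%SET;
  src_neq_dst : forall i, src i != dst i;
  hd_source : forall e i, origin e = inr i -> hd e = src i;
  card_source : forall i : 'I_k,
    #|[set e | origin e == inr i]%SET| = mincut origin hd (src i) (dst i) }.

Section SideInformation.
Variables (k : nat) (N : network k).

Definition closed_tail (e : link N) : node N :=
  match origin e with inl v => v | inr i => dst N i end.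

Definition side_info_edge : rel (link N) := fun e e' => hd e' == closed_tail e.

Lemma side_info_edge_irr : irreflexive side_info_edge.
Proof.
move=> e; apply/negP; rewrite /side_info_edge /closed_tail.
case oe: (origin e) => [v|i] /eqP he.
- have: [:: v] = [::]; last by [].
  apply: (network_acyclic (n := N)); first by move=> x _; rewrite inE.
  rewrite /ucycle /= !andbT; apply/existsP; exists e.
  by rewrite inE oe he !eqxx.
- by have := src_neq_dst N i; rewrite -(hd_source oe) he eqxx.
Qed.

Definition side_info_digraph : digraph := Digraph side_info_edge_irr.

End SideInformation.

Section Independence.
Variables (Omega I : finType) (T : I -> finType).

Definition counting_prob (A : {set Omega}) : rat := #|A|%:R / #|Omega|%:R.

Definition mutually_independent (Y : forall i, Omega -> T i) : Prop :=
  forall B : (forall i, {set T i}),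
    counting_prob [set w | [forall i, Y i w \in B i]]%SET =
    \prod_(i : I) counting_prob [set w | Y i w \in B i]%SET.

End Independence.

Section NetworkCoding.
Variables (k : nat) (N : network k) (F : finFieldType).

Section Codes.
Variables p r : nat.

(* On link [e], the message [x] produces the vector [x *m Z e]. *)
Variable Z : link N -> 'M[F]_(r, p).

Definition linear_in_flow_into (v : node N) (e : link N) : Prop :=
  exists M : link N -> 'M[F]_p, forall x : 'rV[F]_r,
    x *m Z e = \sum_(a | hd a == v) (x *m Z a) *m M a.

Definition relaxed_code : Prop :=
  [/\ forall x y : 'rV[F]_r,
        (forall e i, origin e = inr i -> x *m Z e = y *m Z e) -> x = y,
      forall e v, origin e = inl v -> linear_in_flow_into v e &
      forall e i, origin e = inr i -> linear_in_flow_into (dst N i) e].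

Definition source_symbols (i : 'I_k) (x : 'rV[F]_r) :
    {ffun {e : link N | origin e == inr i} -> 'rV[F]_p} :=
  [ffun e => x *m Z (val e)].

Definition MU_code : Prop :=
  relaxed_code /\ mutually_independent source_symbols.

End Codes.

Definition RCO_over (R : realType) : \bar R :=
  ereal_sup [set y | exists p r (Z : link N -> 'M[F]_(r, p)),
    [/\ (0 < p)%N, relaxed_code Z & y = (r%:R / p%:R)%:E]].

Definition RMU_over (R : realType) : \bar R :=
  ereal_sup [set y | exists p r (Z : link N -> 'M[F]_(r, p)),
    [/\ (0 < p)%N, MU_code Z & y = (r%:R / p%:R)%:E]].

End NetworkCoding.

Definition RCO (R : realType) (k : nat) (N : network k) : \bar R :=
  ereal_sup [set y | exists F : finFieldType, y = RCO_over N F R].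

Definition RMU (R : realType) (k : nat) (N : network k) : \bar R :=
  ereal_sup [set y | exists F : finFieldType, y = RMU_over N F R].

(* Main.v *)
(* A relaxed-correlated code is, up to the choice of a parametrisation, an
   r-dimensional subspace W of F^(mp) on which each block x_e is a function of
   the blocks x_a with h(a) = t(e) in the closed-up network.  A linear index
   code for G is a linear map on F^(mp) whose kernel has exactly that property.
   Passing from W to the quotient map by W, and from an index code to its
   kernel, exchanges rates r/p and m - r/p.
   For the last bound, an index code of rate r/p satisfies p |A| <= r for every
   acyclic A, because a nonzero message supported on A and encoded as 0 would
   be decoded as 0 at a sink of its support; and the q-th tensor power of the
   code is an index code of rate (r/p)^q for the q-th strong power. *)
Require Import Defs.
From mathcomp Require Import all_boot all_order all_algebra.
From mathcomp Require Import all_classical all_reals all_analysis.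
From mathcomp Require Import mxtens.

Set Implicit Arguments.
Unset Strict Implicit.
Unset Printing Implicit Defensive.

Import Order.TTheory GRing.Theory Num.Theory.

Local Open Scope ring_scope.

(** * Sinks in acyclic vertex sets *)

Section Acyclic.
Context {T : finType}.
Implicit Types (e : rel T) (A B : {set T}).

Lemma acyclic_on_rev e A :
  acyclic_on e A -> acyclic_on (fun x y => e y x) A.
Proof.
move=> acy c cA /andP[cyc uc].
have /(congr1 rev) : rev c = [::]; last by rewrite revK.
apply: acy => [x|]; first by rewrite mem_rev; exact: cA.
by rewrite /ucycle rev_cycle cyc rev_uniq.
Qed.

(** Take the vertex of [B] that reaches the fewest vertices inside [B]. An edge from it to some [j]
    in [B] would make the reach of [j] strictly smaller, since no path leads back. *)
Lemma acyclic_on_sink e A B x : acyclic_on e A -> B \subset A -> x \in B ->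
  exists2 i, i \in B & forall j, j \in B -> ~~ e i j.
Proof.
move=> acy sBA xB.
pose e' := [rel u v | [&& u \in B, v \in B & e u v]].
(* A return path, shortened to a simple one, would close up with the edge into a cycle inside
   [A]. *)
have no_return u v : e' u v -> ~~ connect e' v u.
  move=> /= /and3P[uB vB euv]; apply/negP => /connectP[p0 p0P u_last].
  case/shortenP: p0P u_last => p pP up _ u_last.
  have : v :: p = [::]; last by [].
  have sB : {subset v :: p <= B}.
    move=> w; rewrite inE => /predU1P[->//|wp].
    have /(_ w wp) : forall z, z \in p -> z \in B; last by [].
    elim: p v {vB euv up u_last wp} pP => // z p IH v /= /andP[/and3P[_ zB _] pP] y.
    by rewrite inE => /predU1P[->//|]; exact: IH pP _.
  apply: acy => [w wvp|]; first by move/fintype.subsetP: sBA; apply; exact: sB.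
  rewrite /ucycle up andbT /= rcons_path -u_last euv andbT.
  by apply: sub_path pP => a b /= /and3P[].
have [i iB mini] := arg_minnP (fun i => #|[set w | connect e' i w]|) xB.
have {}iB : i \in B by [].
exists i => // j jB; apply/negP => eij.
have e'ij : e' i j by rewrite /= iB jB.
have := mini j jB; rewrite leqNgt => /negP; apply.
apply: proper_card; apply/properP; split.
  by apply/fintype.subsetP => w; rewrite !inE; apply: connect_trans; exact: connect1.
by exists i; rewrite !inE ?connect0 //; exact: no_return.
Qed.

End Acyclic.

(** * Block matrices indexed by a finite type *)

Section Blocks.
Context {F : fieldType} {T : finType} {p : nat}.

(** Families over [T] are flattened along the enumeration of [T], so that ranks, kernels and
    cokernels apply to whole codes. *)
Definition of_blocks m (x : T -> 'M[F]_(m, p)) :=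
  \mxrow_(i < #|T|) x (enum_val i).
Definition block m (x : 'M[F]_(m, \sum_(i < #|T|) p)) (v : T) : 'M[F]_(m, p) :=
  submxrow x (enum_rank v).
Definition col_blocks r (C : T -> 'M[F]_(p, r)) :=
  \mxcol_(i < #|T|) C (enum_val i).
Definition col_block r (C : 'M[F]_(\sum_(i < #|T|) p, r)) (v : T) :
  'M[F]_(p, r) := submxcol C (enum_rank v).

Lemma of_blocksK m (x : T -> 'M[F]_(m, p)) v : block (of_blocks x) v = x v.
Proof. by rewrite /block /of_blocks mxrowK enum_rankK. Qed.

Lemma col_blockK r (C : 'M[F]_(\sum_(i < #|T|) p, r)) :
  col_blocks (col_block C) = C.
Proof.
rewrite -[RHS]submxcolK; apply: eq_mxcol => i.
by rewrite /col_block enum_valK.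
Qed.

Lemma block_inj m (x y : 'M[F]_(m, \sum_(i < #|T|) p)) :
  block x =1 block y -> x = y.
Proof.
move=> eqxy; rewrite -[x]submxrowK -[y]submxrowK; apply: eq_mxrow => i.
by have := eqxy (enum_val i); rewrite /block enum_valK.
Qed.

Lemma mul_block m n (x : 'M[F]_(m, n)) (y : 'M[F]_(n, \sum_(i < #|T|) p)) v :
  block (x *m y) v = x *m block y v.
Proof. by rewrite /block mul_submxrow. Qed.

Lemma mul_of_blocks m r (x : T -> 'M[F]_(m, p)) (C : T -> 'M[F]_(p, r)) :
  of_blocks x *m col_blocks C = \sum_v x v *m C v.
Proof.
rewrite mul_mxrow_mxcol [RHS](reindex (@enum_val T T)) //=.
exact/onW_bij/enum_val_bij.
Qed.

Lemma mul_blocks m r (x : 'M[F]_(m, \sum_(i < #|T|) p))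
    (C : T -> 'M[F]_(p, r)) :
  x *m col_blocks C = \sum_v block x v *m C v.
Proof.
rewrite -mul_of_blocks; congr (_ *m _); apply: block_inj => v.
by rewrite of_blocksK.
Qed.

Lemma blocks_dim : (\sum_(i < #|T|) p = #|T| * p)%N.
Proof. by rewrite sum_nat_const card_ord. Qed.

Lemma block0 m v : block (0 : 'M[F]_(m, _)) v = 0.
Proof. by rewrite /block submxrow0. Qed.

End Blocks.

(** Inclusion of left kernels becomes, after transposition, inclusion of a row space in a sum of row
    spaces; the coefficients of that inclusion give [M]. *)
Lemma factor_through_family {F : fieldType} {T : finType} (P : pred T)
    {k p p' : nat} (A : T -> 'M[F]_(k, p)) (B : 'M[F]_(k, p')) :
  (forall w : 'rV_k, (forall a, P a -> w *m A a = 0) -> w *m B = 0) ->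
  exists M : T -> 'M[F]_(p, p'), B = \sum_(a | P a) A a *m M a.
Proof.
move=> kerB.
have : (B^T <= \sum_(a | P a) <<(A a)^T>>)%MS.
  rewrite submxE; set S := (\sum_(a | P a) _)%MS.
  apply/eqP/trmx_inj; rewrite trmx_mul trmxK trmx0.
  apply/row_matrixP => i; rewrite row_mul row0; apply: kerB => a Pa.
  rewrite -row_mul; apply: (can_inj trmxK); rewrite trmx0 tr_row trmx_mul trmxK.
  have : ((A a)^T <= S)%MS by apply: (sumsmx_sup a); rewrite ?genmxE.
  by rewrite submxE => /eqP ->; rewrite col0.
move=> /sub_sums_genmxP[u Bu].
exists (fun a => (u a)^T); rewrite -[LHS]trmxK Bu linear_sum /=.
by apply: eq_bigr => a _; rewrite trmx_mul trmxK.
Qed.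

Lemma tensmx1 (R : comPzRingType) m n :
  1%:M *t 1%:M = 1%:M :> 'M[R]_(m * n).
Proof.
apply/matrixP => i j; case: (mxtens_indexP i) => a b.
case: (mxtens_indexP j) => c d.
by rewrite tensmxE !mxE (can_eq (@mxtens_indexK m n)) xpair_eqE -natrM mulnb.
Qed.

(** * Linear index codes, strong products and the acyclic bound *)

Section IndexCodes.
Context {F : finFieldType}.
Implicit Types G H : digraph.

(** By linearity, two messages that user [i] cannot tell apart differ by one that is sent as 0 and
    vanishes on the side information. *)
Lemma index_codeP G p r (C : G -> 'M[F]_(p, r)) :
  index_code C <->
  (forall (i : G) (x : G -> 'rV[F]_p), \sum_v x v *m C v = 0 ->
     (forall j, edge i j -> x j = 0) -> x i = 0).
Proof.
split=> [code i x x0 xnbr|code i].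
  have [D DP] := code i; rewrite -(DP x) x0.
  have := DP (fun=> 0); rewrite big1 => [|v _]; last by rewrite mul0mx.
  move=> D0; apply: etrans D0; congr (D _ _); apply/ffunP => j; rewrite !ffunE.
  by rewrite xnbr // (valP j).
pose sent (x : G -> 'rV[F]_p) := \sum_v x v *m C v.
pose known (x : G -> 'rV[F]_p) :=
  [ffun j : {j : G | edge i j} => x (val j)].
(* All messages compatible with the observation [ys] share their [i]-th block, which is decoded; the
   default is 0 when none is compatible. *)
have /boolp.choice[D DP] : forall ys : 'rV[F]_r * {ffun {j : G | edge i j} -> 'rV[F]_p},
    exists z, forall x, sent x = ys.1 -> known x = ys.2 -> x i = z.
  move=> ys.
  have [[x [xs xk]]|no_x] := boolp.pselect (exists x, sent x = ys.1 /\ known x = ys.2).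
    exists (x i) => y ys' yk; apply/eqP; rewrite -subr_eq0; apply/eqP.
    apply: (code i (fun v => y v - x v)).
      under eq_bigr do rewrite mulmxBl.
      by rewrite sumrB -/(sent y) -/(sent x) ys' xs subrr.
    move=> j eij; have /ffunP/(_ (Sub j eij)) := etrans yk (esym xk).
    by rewrite !ffunE /= => ->; rewrite subrr.
  by exists 0 => x xs xk; case: no_x; exists x.
by exists (fun y s => D (y, s)) => x; symmetry; exact: DP.
Qed.

(** Decoders in [index_code] are arbitrary functions, while tensoring needs linear ones. The rows of
    [C i] are independent modulo the span [S] of the interfering blocks, so [D] projects modulo [S]
    and then inverts. *)
Lemma index_code_decoder G p r (C : G -> 'M[F]_(p, r)) (i : G) :
  index_code C ->
  exists D : 'M[F]_(r, p),
    C i *m D = 1%:M /\ forall j, j != i -> ~~ edge i j -> C j *m D = 0.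
Proof.
move=> /index_codeP/(_ i) code.
pose P j := (j != i) && ~~ edge i j.
pose S := (\sum_(j | P j) <<C j>>)%MS.
have free : row_free (C i *m cokermx S).
  apply: inj_row_free => u; rewrite mulmxA => /eqP; rewrite -submxE.
  move=> /sub_sums_genmxP[w uC].
  (* The interferers cancel [u *m C i], and the side information of [i] is 0, so decodability forces
     [u = 0]. *)
  pose x j := if j == i then u else if P j then - w j else 0.
  rewrite -(_ : x i = u); last by rewrite /x eqxx.
  apply: code => [|j eij]; last first.
    rewrite /x /P eij andbF; case: eqP => // ji.
    by rewrite ji edge_irr in eij.
  rewrite (bigD1 i) //= {1}/x eqxx uC.
  rewrite [X in _ + X](bigID (fun j => ~~ edge i j)) /=.
  rewrite [X in _ + (_ + X)]big1 ?addr0; last first.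
    by move=> j /andP[ji /negPn eij]; rewrite /x (negPf ji) /P eij andbF mul0mx.
  rewrite -big_split /= big1 // => j Pj.
  by rewrite /x (negPf (proj1 (andP Pj))) ifT // mulNmx subrr.
exists (cokermx S *m pinvmx (C i *m cokermx S)); split.
  by rewrite mulmxA mulmxVp.
move=> j ji neij; rewrite mulmxA.
have : (C j <= S)%MS by apply: (sumsmx_sup j); rewrite ?genmxE // /P ji.
by rewrite submxE => /eqP ->; rewrite mul0mx.
Qed.

Lemma acyclic_index_code_size G p r (C : G -> 'M[F]_(p, r)) (A : {set G}) :
  index_code C -> acyclic_on (@edge G) A -> (#|A| * p <= r)%N.
Proof.
move=> /index_codeP code acy.
pose CA (v : {v | v \in A}) := C (val v).
(* Independence of these [#|A| * p] rows of length [r] is the bound. *)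
suff free : row_free (col_blocks CA).
  have <- : #|{: {v | v \in A}}| = #|A| by rewrite card_sig.
  by rewrite -blocks_dim -(eqP free) rank_leq_col.
apply: inj_row_free => w; rewrite mul_blocks => w0.
pose x v := if insub v is Some u then block w u else 0.
have x0 : \sum_v x v *m C v = 0.
  rewrite -[RHS]w0 (bigID (mem A)) /= [X in _ + X]big1 ?addr0.
    by rewrite big_sub; apply: eq_bigr => v _; rewrite /x valK.
  by move=> v vA; rewrite /x insubN // mul0mx.
suff xE v : x v = 0.
  by apply: block_inj => u; rewrite block0 -(xE (val u)) /x valK.
apply/eqP/negPn/negP => xv0.
have sBA : [set v | x v != 0] \subset A.
  apply/fintype.subsetP => u; rewrite inE; apply: contraNT => uA.
  by rewrite /x insubN.
have vB : v \in [set v | x v != 0] by rewrite inE.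
have [i] := acyclic_on_sink acy sBA vB.
rewrite inE => xi i_sink; case/negP: xi; apply/eqP/code => // j eij.
by apply/eqP/negPn; apply: contraL eij => xj; rewrite i_sink ?inE.
Qed.

(** The tensor product of the two linear decoders decodes: a different vertex that is not an
    out-neighbour fails in some coordinate, and the decoder of that coordinate kills its block. *)
Lemma index_code_strong_prod G H p r p' r'
    (C : G -> 'M[F]_(p, r)) (C' : H -> 'M[F]_(p', r')) :
  index_code C -> index_code C' ->
  @index_code (strong_prod G H) F (p * p') (r * r')
    (fun v => C v.1 *t C' v.2).
Proof.
move=> code code'; apply/index_codeP => -[i i'] x x0 xnbr.
have [D [CD CDn]] := index_code_decoder i code.
have [D' [CD' CDn']] := index_code_decoder i' code'.
have /(congr1 (mulmx^~ (D *t D'))) := x0; rewrite mul0mx mulmx_suml.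
rewrite (bigD1 (i, i')) //= big1 ?addr0.
  by rewrite -mulmxA tensmx_mul CD CD' tensmx1 mulmx1.
move=> [j j'] /= neq.
have [e|] := boolP (edge (d := strong_prod G H) (i, i') (j, j')).
  by rewrite xnbr // !mul0mx.
rewrite -mulmxA tensmx_mul /edge /= /strong_edge /= eq_sym neq /= negb_and !negb_or.
case/orP => /andP[ij nij].
  by rewrite CDn // 1?eq_sym // tens0mx mulmx0.
by rewrite CDn' // 1?eq_sym // tensmx0 mulmx0.
Qed.

Lemma index_code_strong_power G p r (C : G -> 'M[F]_(p, r)) q :
  index_code C ->
  exists C' : strong_power G q.+1 -> 'M[F]_(p ^ q.+1, r ^ q.+1), index_code C'.
Proof.
move=> code; elim: q => [|q [C' code']]; first by exists C.
by eexists; apply: index_code_strong_prod code code'.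
Qed.

Lemma MAIS_strong_power_le G p r (C : G -> 'M[F]_(p, r)) q : (0 < q)%N ->
  index_code C -> (MAIS (strong_power G q) * p ^ q <= r ^ q)%N.
Proof.
case: q => // q _ /(index_code_strong_power q)[C' code'].
have [p0|p_gt0] := posnP (p ^ q.+1)%N; first by rewrite p0 muln0.
rewrite -leq_divRL //; apply/bigmax_leqP => A /asboolP acy.
by rewrite leq_divRL // (acyclic_index_code_size code' acy).
Qed.

End IndexCodes.

(** * Relaxed-correlated codes against index codes *)

Section Networks.
Context {k : nat} {N : network k} {F : finFieldType}.
Implicit Types (p r : nat).

(** Injectivity on the source links amounts to injectivity on all links, because in an acyclic
    network the source symbols determine all others. *)
Lemma relaxed_codeP p r (Z : link N -> 'M[F]_(r, p)) :
  relaxed_code Z <->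
  (forall x : 'rV_r, (forall e, x *m Z e = 0) -> x = 0) /\
  (forall e, linear_in_flow_into Z (closed_tail e) e).
Proof.
split=> [[inj lin_inner lin_src]|[inj lin]].
  split=> [x xZ|e].
    by apply: inj => e i _; rewrite xZ mul0mx.
  by rewrite /closed_tail; case oe: (origin e) => [v|i]; [exact: lin_inner|exact: lin_src].
split=> [x y xy|e v oe|e i oe].
- apply/eqP; rewrite -subr_eq0; apply/eqP/inj.
  set z := x - y => e.
  (* [B] collects the nodes entered by a nonzero symbol. A sink of [B] for the reversed edges has no
     predecessor in [B], so its nonzero incoming link could only be a source link, where [z]
     vanishes. *)
  pose B := [set v : node N | [exists e, (hd e == v) && (z *m Z e != 0)]].
  apply/eqP/negPn/negP => ze0.
  have eB : hd e \in B by rewrite inE; apply/existsP; exists e; rewrite eqxx.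
  have [v] := acyclic_on_sink
    (acyclic_on_rev (network_acyclic (n := N))) (finset.subsetT B) eB.
  rewrite inE => /existsP[f /andP[/eqP fv zf0]] src.
  case of_: (origin f) => [u|i].
    have [M ZM] := lin f; case/negP: zf0; rewrite ZM big1 // => a.
    rewrite /closed_tail of_ => /eqP au.
    apply/eqP; apply: contraT => za0.
    have : u \in B.
      rewrite inE; apply/existsP; exists a; rewrite au eqxx /=.
      by apply: contraNN za0 => /eqP ->; rewrite mul0mx.
    move=> /src /negP[]; apply/existsP; exists f.
    by rewrite inE of_ fv !eqxx.
  by case/negP: zf0; rewrite mulmxBl (xy _ _ of_) subrr.
- by have := lin e; rewrite /closed_tail oe.
- by have := lin e; rewrite /closed_tail oe.
Qed.

Lemma index_code_of_relaxed p r (Z : link N -> 'M[F]_(r, p)) :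
  relaxed_code Z -> (r <= #|link N| * p)%N /\
  exists C : side_info_digraph N -> 'M[F]_(p, #|link N| * p - r), index_code C.
Proof.
move=> /relaxed_codeP[inj lin].
have free : row_free (of_blocks Z).
  apply: inj_row_free => x xZ; apply: inj => e.
  by rewrite -[Z e](of_blocksK Z) -mul_block xZ block0.
have rk := eqP free.
split; first by rewrite -rk -blocks_dim rank_leq_col.
have <- : \rank (cokermx (of_blocks Z)) = (#|link N| * p - r)%N.
  by rewrite mxrank_coker rk blocks_dim.
set K := cokermx _.
(* [col_base] keeps a basis of the columns of the cokernel: the width drops to [#|link N| * p - r],
   and the left kernel is still the row space of [Z]. *)
exists (col_block (col_base K)).
apply/index_codeP => i x; rewrite -mul_of_blocks col_blockK => x0 xnbr.
have /submxP[w xw] : (of_blocks x <= of_blocks Z)%MS.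
  by rewrite submxE -/K -(mulmx_base K) mulmxA x0 mul0mx.
have {xw}xw v : x v = w *m Z v.
  by rewrite -(of_blocksK x) xw mul_block of_blocksK.
have [M ZM] := lin i; rewrite xw ZM big1 // => a ai.
by rewrite -xw xnbr ?mul0mx.
Qed.

(** Only an inequality holds, since the transmitted symbols may be redundant: [r'] is the dimension
    of the kernel of the code, and a basis of that kernel gives [Z]. *)
Lemma relaxed_of_index_code p r
    (C : side_info_digraph N -> 'M[F]_(p, r)) : index_code C ->
  exists2 r', (#|link N| * p <= r + r')%N &
    exists Z : link N -> 'M[F]_(r', p), relaxed_code Z.
Proof.
move=> /index_codeP code.
pose K := kermx (col_blocks (T := link N) C).
exists (\rank K).
  by rewrite mxrank_ker -leq_subLR -blocks_dim leq_sub2l // rank_leq_col.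
exists (block (row_base K)); apply/relaxed_codeP; split=> [x x0|e].
  apply: (row_free_inj (row_base_free K)); rewrite mul0mx.
  by apply: block_inj => e; rewrite mul_block x0 block0.
have [|M BM] := factor_through_family
    (P := fun a => hd a == closed_tail e)
    (A := block (row_base K)) (B := block (row_base K) e).
  move=> w wnbr.
  apply: (code e (fun v => w *m block (row_base K) v)) => [|j ej].
    transitivity (\sum_(v : link N) block (w *m row_base K) v *m C v).
      by apply: eq_bigr => v _; rewrite (mul_block w).
    rewrite -mul_blocks -mulmxA.
    have /sub_kermxP -> : (row_base K <= K)%MS by rewrite eq_row_base.
    by rewrite mulmx0.
  exact: wnbr.
exists M => x; rewrite {1}BM mulmx_sumr; apply: eq_bigr => a _.
by rewrite mulmxA.
Qed.

End Networks.

Lemma relaxed_code0 k (N : network k) (F : finFieldType) p :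
  relaxed_code (fun _ : link N => 0 : 'M[F]_(0, p)).
Proof.
apply/relaxed_codeP; split=> [x _|e]; first exact: thinmx0.
by exists (fun=> 0) => x; rewrite mulmx0 big1 // => a _; rewrite mulmx0.
Qed.

Local Open Scope ereal_scope.

(** * Passage to optimal rates *)

Section Rates.
Context {R : realType}.

Lemma beta_VL_ge0 G : 0 <= beta_VL R G.
Proof.
apply: le_ereal_inf_tmp => _ [F ->]; apply: le_ereal_inf_tmp => _ [p [r [C [_ _ ->]]]].
by rewrite lee_fin divr_ge0.
Qed.

Lemma MAIS_le_beta_VL G q : (0 < q)%N ->
  ((MAIS (strong_power G q))%:R `^ q%:R^-1)%:E <= beta_VL R G.
Proof.
move=> q0.
apply: le_ereal_inf_tmp => _ [F ->].
apply: le_ereal_inf_tmp => _ [p [r [C [p0 code ->]]]].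
have := MAIS_strong_power_le q0 code.
rewrite -(ler_nat R) natrM !natrX -ler_pdivlMr ?exprn_gt0 ?ltr0n // -expr_div_n.
move=> le; rewrite lee_fin.
have rp0 : (0 <= r%:R / p%:R :> R)%R by rewrite divr_ge0.
have -> : (r%:R / p%:R = ((r%:R / p%:R) ^+ q) `^ q%:R^-1 :> R)%R.
  by rewrite -powR_mulrn // -powRrM divff ?powRr1 // pnatr_eq0 -lt0n.
by apply: ge0_ler_powR; rewrite ?nnegrE ?invr_ge0 // exprn_ge0.
Qed.

Lemma RCO_eq k (N : network k) :
  RCO R N = #|link N|%:R%:E - beta_VL R (side_info_digraph N).
Proof.
set m := #|link N|; set G := side_info_digraph N; set b := beta_VL R G.
have rateE p r : (0 < p)%N -> (r <= m * p)%N ->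
    (m%:R - r%:R / p%:R = (m * p - r)%:R / p%:R :> R)%R.
  by move=> p0 rm; rewrite natrB // natrM mulrBl mulfK // pnatr_eq0 -lt0n.
(* The network code with the empty message ([r = 0]) yields an index code of rate [m], which keeps
   the infimum finite. *)
have b_fin : b \is a fin_num.
  rewrite ge0_fin_numE ?beta_VL_ge0 //.
  have [_ [C code]] := index_code_of_relaxed (relaxed_code0 N 'F_2 1).
  apply: le_lt_trans (ltry m%:R).
  apply: le_trans (ereal_inf_lbound _) _; first by exists 'F_2.
  apply: ereal_inf_lbound; exists 1%N, (m * 1 - 0)%N, C; split=> //.
  by rewrite muln1 subn0 divr1.
have RCO_le : RCO R N <= m%:R%:E - b.
  apply: ge_ereal_sup => _ [F ->].
  apply: ge_ereal_sup => _ [p [r [Z [p0 code ->]]]].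
  have [rm [C Ccode]] := index_code_of_relaxed code.
  rewrite leeBrDl // -leeBrDr // -EFinB rateE //.
  apply: le_trans (ereal_inf_lbound _) _; first by exists F.
  by apply: ereal_inf_lbound; exists p, (m * p - r)%N, C.
apply/eqP; rewrite eq_le RCO_le /=.
have RCO_ge0 : 0 <= RCO R N.
  apply: le_ereal_sup_tmp; exists (RCO_over N 'F_2 R); first by exists 'F_2.
  apply: ereal_sup_ubound; exists 1%N, 0%N, (fun=> 0%R).
  by split=> //; [exact: relaxed_code0|rewrite mul0r].
have RCO_fin : RCO R N \is a fin_num.
  rewrite ge0_fin_numE //; apply: le_lt_trans RCO_le _.
  by rewrite ltey_eq fin_numB b_fin.
rewrite leeBlDr // -leeBlDl //.
apply: le_ereal_inf_tmp => _ [F ->].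
apply: le_ereal_inf_tmp => _ [p [r [C [p0 code ->]]]].
have [r' rr' [Z Zcode]] := relaxed_of_index_code code.
rewrite leeBlDl // -leeBlDr // -EFinB.
apply: le_ereal_sup_tmp; exists (RCO_over N F R); first by exists F.
apply: le_ereal_sup_tmp; exists (r'%:R / p%:R)%:E; first by exists p, r', Z.
rewrite lee_fin lerBlDl -mulrDl ler_pdivlMr ?ltr0n //.
by rewrite -natrM -natrD ler_nat.
Qed.

End Rates.

Theorem theorem2 (R : realType) (k : nat) (N : network k) (q : nat)
    (q_gt0 : (0 < q)%N) :
  let m := #|link N| in
  let G := side_info_digraph N in
  [/\ RMU R N <= RCO R N,
      RCO R N = m%:R%:E - beta_VL R G &
      m%:R%:E - beta_VL R G <=
        (m%:R - (MAIS (strong_power G q))%:R `^ (q%:R^-1))%R%:E].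
Proof.
move=> m G; split.
- apply: ge_ereal_sup => _ [F ->]; apply: le_ereal_sup_tmp.
  exists (RCO_over N F R); first by exists F.
  apply: ereal_sup_le => _ [p [r [Z [p0 [code _] ->]]]].
  by exists p, r, Z.
- exact: RCO_eq.
- by rewrite EFinB leeB // MAIS_le_beta_VL.
Qed.
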